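(* Let $X$ be a ball Banach function space on $\mathbb R^n$, let $1<q<\infty$, and assume that there is a constant $C>0$ such that $$\left\|\Big(\sum_{j=1}^N(\mathcal M f_j)^q\Big)^{1/q}\right\|_X\le C\left\|\Big(\sum_{j=1}^N|f_j|^q\Big)^{1/q}\right\|_X$$ for every $N\in\mathbb N$ and every finite family $\{f_j\}_{j=1}^N$ of measurable functions for which the right-hand side is finite. Let $m\in\mathbb N$ satisfy $m>q$, let $0<\eta<1$, and let $\mathscr S$ be a finite $\eta$-sparse subcollection of a dyadic grid. Then $$\|\mathcal A_{\mathscr S}f\|_X\le\Gamma_{q,m}\,\big(\eta^{-1}C^2\big)^m\,\|f\|_X\qquad(f\in X),$$ where $$\Gamma_{q,m}=\left(\sum_{\ell=1}^{\infty}\binom{\ell+m-2}{m-1}^{-1/(q-1)}\right)^{1/q'},\qquad q'=\frac q{q-1}.$$ In particular, the constant is independent of the dyadic grid and of $\mathscr S$.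
   Context: Functions on $\mathbb R^n$ are identified when equal a.e. (Lebesgue measure). Ball Banach function space $X$: a complete normed linear space of measurable functions on $\mathbb R^n$ such that (1) if $f\in X$ and $|g|\le|f|$ a.e. with $g$ measurable, then $g\in X$ and $\|g\|_X\le\|f\|_X$; (2) (Fatou) if $f_k\in X$, $0\le f_k\uparrow f$ a.e. and $\sup_k\|f_k\|_X<\infty$, then $f\in X$ and $\|f\|_X=\sup_k\|f_k\|_X$; (3) $\mathbf 1_B\in X$ for every ball $B$; (4) for every ball $B$ there is $C_B$ with $\int_B|f|\,dx\le C_B\|f\|_X$ for all $f\in X$. If a (possibly extended-valued) measurable function is not in $X$, its norm is taken to be $+\infty$. $\mathcal M f(x)=\sup_Q\mathbf 1_Q(x)\langle|f|\rangle_Q\in[0,\infty]$ over all axis-parallel cubes $Q\subset\mathbb R^n$, where $\langle f\rangle_Q=\frac1{|Q|}\int_Qf$ (integrals of $|f|$ may be $+\infty$; $0\cdot\infty=0$). For a finite collection $\mathscr S$ of cubes, $\mathcal A_{\mathscr S}f=\sum_{Q\in\mathscr S}\langle|f|\rangle_Q\mathbf 1_Q$. Dyadic grid: a collection $\mathscr D=\bigcup_{k\in\mathbb Z}\mathscr D_k$ of half-open cubes $\prod_{i=1}^n[a_i,a_i+\ell)$ such that each $\mathscr D_k$ is a partition of $\mathbb R^n$ into cubes of side length $2^{-k}$; every $Q\in\mathscr D_k$ is contained in a unique cube of $\mathscr D_{k-1}$ and is the disjoint union of exactly $2^n$ cubes of $\mathscr D_{k+1}$; and any $P,Q\in\mathscr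 D$ satisfy $P\cap Q=\varnothing$, $P\subset Q$ or $Q\subset P$. A collection $\mathscr S$ of cubes is $\eta$-sparse ($0<\eta<1$) if there are pairwise disjoint measurable sets $E_Q\subset Q$, $Q\in\mathscr S$, with $|E_Q|\ge\eta|Q|$. *)

(* Defs.v *)
From HB Require Import structures.
From mathcomp Require Import all_boot all_order all_algebra.
From mathcomp Require Import all_classical all_reals all_analysis.

Set Implicit Arguments.
Unset Strict Implicit.
Unset Printing Implicit Defensive.

Import Order.TTheory GRing.Theory Num.Theory.
Import numFieldNormedType.Exports.

Local Open Scope classical_set_scope.
Local Open Scope ring_scope.

Definition tuple_uncons (R : realType) (n : nat)
    (t : n.+1.-tuple (measurableTypeR R)) :
    measurableTypeR R * n.-tuple (measurableTypeR R) :=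
  (thead t, [tuple of behead t]).

Definition tuple_cons (R : realType) (n : nat)
    (p : measurableTypeR R * n.-tuple (measurableTypeR R)) :
    n.+1.-tuple (measurableTypeR R) :=
  [tuple of p.1 :: p.2].

Lemma measurable_tuple_cons (R : realType) (n : nat) :
  measurable_fun [set: _] (@tuple_cons R n).
Proof. exact: measurable_cons. Qed.

Lemma measurable_tuple_uncons (R : realType) (n : nat) :
  measurable_fun [set: _] (@tuple_uncons R n).
Proof.
apply/measurable_fun_pairP; split; first exact: measurable_tnth.
exact: measurable_behead.
Qed.

Lemma tuple_consK (R : realType) (n : nat) :
  cancel (@tuple_cons R n) (@tuple_uncons R n).
Proof.
by case=> x t; rewrite /tuple_uncons /= theadE; congr (_, _); exact/val_inj.
Qed.

Definition lebesgue_measure_cons (R : realType) (n : nat)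
    (mu : {sigma_finite_measure
      set (n.-tuple (measurableTypeR R)) -> \bar R}) :
    set (n.+1.-tuple (measurableTypeR R)) -> \bar R :=
  pushforward (@lebesgue_measure R \x mu)%E (@tuple_cons R n).

Section lebesgue_measure_cons_instances.
Context (R : realType) (n : nat).
Context (mu : {sigma_finite_measure
  set (n.-tuple (measurableTypeR R)) -> \bar R}).

Let nu := lebesgue_measure_cons mu.

Let nu0 : nu set0 = 0%E.
Proof.
by rewrite /nu /lebesgue_measure_cons /pushforward preimage_set0 measure0.
Qed.

Let nu_ge0 A : (0 <= nu A)%E.
Proof.
by rewrite /nu /lebesgue_measure_cons /pushforward; exact: measure_ge0.
Qed.

Let nu_sigma_additive : semi_sigma_additive nu.
Proof.
move=> F mF tF mUF; rewrite /nu /lebesgue_measure_cons /pushforward.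
rewrite preimage_bigcup; apply: measure_semi_sigma_additive.
- move=> k; rewrite -[X in measurable X]setTI.
  exact: measurable_tuple_cons.
- apply/trivIsetP => /= i j _ _ ij; rewrite -preimage_setI.
  by move/trivIsetP : tF => /(_ _ _ _ _ ij) ->//; rewrite preimage_set0.
- rewrite -preimage_bigcup -[X in measurable X]setTI.
  exact: measurable_tuple_cons.
Qed.

HB.instance Definition _ := isMeasure.Build _ _ _ (lebesgue_measure_cons mu)
  nu0 nu_ge0 nu_sigma_additive.

Let nu_sigma_finite : sigma_finite setT nu.
Proof.
have /sigma_finiteP[F [TF ndF Foo]] := sigma_finiteT (@lebesgue_measure R).
have /sigma_finiteP[G [TG ndG Goo]] := sigma_finiteT mu.
exists (fun k => @tuple_uncons R n @^-1` (F k `*` G k)).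
  rewrite -preimage_bigcup -[LHS](preimage_setT (@tuple_uncons R n)).
  congr (_ @^-1` _); rewrite -setXTT TF TG; apply/seteqP; split => -[x y].
    move=> [/= [i _ Fix] [j _ Gjy]]; exists (maxn i j) => //; split.
    - by move: x Fix; exact/subsetPset/ndF/leq_maxl.
    - by move: y Gjy; exact/subsetPset/ndG/leq_maxr.
  by move=> [i _ []/= ? ?]; split; exists i.
move=> k; have [mF Fkoo] := Foo k; have [mG Gkoo] := Goo k; split.
  rewrite -[X in measurable X]setTI; apply: measurable_tuple_uncons => //.
  exact: measurableX.
rewrite /nu /lebesgue_measure_cons /pushforward -comp_preimage.
rewrite (_ : _ \o _ = id); last by apply/funext => p; exact: tuple_consK.
by rewrite preimage_id product_measure1E// lte_mul_pinfty// ge0_fin_numE.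
Qed.

HB.instance Definition _ := Measure_isSigmaFinite.Build _ _ _
  (lebesgue_measure_cons mu) nu_sigma_finite.

End lebesgue_measure_cons_instances.

(* the n-fold product of the Lebesgue measure on R *)
Fixpoint borel_lebesgue (R : realType) (n : nat) :
    {sigma_finite_measure set (n.-tuple (measurableTypeR R)) -> \bar R} :=
  match n with
  | 0 => \d_([tuple] : 0.-tuple (measurableTypeR R))
  | n'.+1 => lebesgue_measure_cons (borel_lebesgue R n')
  end.

Lemma borel_lebesgue_box (R : realType) (n : nat) (I : 'I_n -> set R) :
  (forall i, measurable (I i : set (measurableTypeR R))) ->
  borel_lebesgue R n [set t | forall i, I i (tnth t i)] =
  (\prod_(i < n) lebesgue_measure (I i))%E.
Proof.
elim: n I => [|n IH] I mI /=.
  rewrite big_ord0 diracE mem_set//= => -[].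
  by [].
rewrite big_ord_recl -IH; last by move=> i; exact: mI.
rewrite /lebesgue_measure_cons /pushforward -product_measure1E//; last first.
  rewrite (_ : [set t | _] =
    \bigcap_(i in [set: 'I_n]) ((fun t => tnth t i) @^-1` I (lift ord0 i))).
    apply: fin_bigcap_measurable; first exact: finite_finset.
    move=> i _; rewrite -[X in measurable X]setTI.
    exact: measurable_tnth.
  by apply/seteqP; split => t /= H i *; exact: H.
congr (_ _); apply/seteqP; split => -[x t] /=.
  move=> H; split; first by have := H ord0; rewrite tnth0.
  by move=> i; have := H (lift ord0 i); rewrite tnthS.
move=> [Ix It] i; case: (unliftP ord0 i) => [j ->|->].
  by rewrite tnthS.
by rewrite tnth0.
Qed.

(* R^n with the sigma-algebra of Lebesgue measurable sets, as opposed to the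
   Borel sets, which are the measurable sets of n.-tuple (measurableTypeR R) *)
Definition euclidean (R : realType) (n : nat) : Type :=
  caratheodory_type (mu_ext (borel_lebesgue R n)).

HB.instance Definition _ (R : realType) (n : nat) :=
  Pointed.on (euclidean R n).
HB.instance Definition _ (R : realType) (n : nat) :=
  Measurable.on (euclidean R n).

Definition lebesgue (R : realType) (n : nat) :
    set (euclidean R n) -> \bar R :=
  @completed_measure_extension _ _ _ (borel_lebesgue R n).

HB.instance Definition _ (R : realType) (n : nat) :=
  Measure.on (@lebesgue R n).

Definition coordinate (R : realType) (n : nat) (x : euclidean R n)
    (i : 'I_n) : R :=
  tnth (x : n.-tuple R) i.

Definition cube (R : realType) (n : nat) (a : euclidean R n) (l : R) :
    set (euclidean R n) :=
  [set x | forall i, coordinate a i <= coordinate x i < coordinate a i + l].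

Lemma lebesgue_cube (R : realType) (n : nat) (a : euclidean R n) (l : R) :
  0 < l -> lebesgue (cube a l) = (l ^+ n)%:E.
Proof.
move=> l0; pose I i := `[coordinate a i, coordinate a i + l[%classic.
have -> : cube a l = [set t : n.-tuple (measurableTypeR R) |
    forall i, I i (tnth t i)].
  by apply/seteqP; split => x + i => /(_ i); rewrite /I /= in_itv.
rewrite /lebesgue /completed_measure_extension measurable_mu_extE; last first.
  rewrite (_ : [set t | _] =
    \bigcap_(i in [set: 'I_n])
      ((fun t : n.-tuple (measurableTypeR R) => tnth t i) @^-1` I i)).
    apply: fin_bigcap_measurable; first exact: finite_finset.
    move=> i _; rewrite -[X in measurable X]setTI.
    by apply: measurable_tnth => //; exact: measurable_itv.
  by apply/seteqP; split => t /= H i *; exact: H.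
transitivity (\prod_(i < n) lebesgue_measure (I i))%E.
  by apply: borel_lebesgue_box => i; exact: measurable_itv.
under eq_bigr => i _.
  rewrite lebesgue_measure_itv/= lte_fin ltrDl l0 -EFinB addrC addKr; over.
by rewrite prodEFin prodr_const card_ord.
Qed.

Definition is_cube (R : realType) (n : nat) (Q : set (euclidean R n)) :=
  exists (a : euclidean R n) (l : R), 0 < l /\ Q = cube a l.

Definition euclidean_ball (R : realType) (n : nat) (c : euclidean R n)
    (r : R) : set (euclidean R n) :=
  [set x | Num.sqrt (\sum_(i < n) (coordinate x i - coordinate c i) ^+ 2) < r].

(* a ball Banach function space, as the set of all real-valued functions
   whose a.e.-class belongs to it *)
Record ballBanachSpace (R : realType) (n : nat) := BallBanachSpace {
  bbs_mem : set (euclidean R n -> R) ;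
  bbs_norm : (euclidean R n -> R) -> R ;
  bbs_measurable : forall f, bbs_mem f -> measurable_fun [set: euclidean R n] f ;
  bbs_ae_eq : forall f g : euclidean R n -> R, bbs_mem f ->
    {ae @lebesgue R n, forall x, f x = g x} ->
    bbs_mem g /\ bbs_norm g = bbs_norm f ;
  bbs_mem0 : bbs_mem (fun=> 0) ;
  bbs_memD : forall f g, bbs_mem f -> bbs_mem g -> bbs_mem (f \+ g) ;
  bbs_memZ : forall (a : R) f, bbs_mem f -> bbs_mem (a \*o f) ;
  bbs_norm_ge0 : forall f, bbs_mem f -> 0 <= bbs_norm f ;
  bbs_norm_eq0 : forall f, bbs_mem f -> bbs_norm f = 0 ->
    {ae @lebesgue R n, forall x, f x = 0} ;
  bbs_normD : forall f g, bbs_mem f -> bbs_mem g ->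
    bbs_norm (f \+ g) <= bbs_norm f + bbs_norm g ;
  bbs_normZ : forall (a : R) f, bbs_mem f ->
    bbs_norm (a \*o f) = `|a| * bbs_norm f ;
  bbs_complete : forall u : nat -> euclidean R n -> R,
    (forall k, bbs_mem (u k)) ->
    (forall e : R, 0 < e -> exists K, forall i j, (K <= i)%N -> (K <= j)%N ->
      bbs_norm (u i \- u j) < e) ->
    exists f, bbs_mem f /\ bbs_norm (u k \- f) @[k --> \oo] --> (0 : R) ;
  bbs_ideal : forall f g : euclidean R n -> R, bbs_mem f -> measurable_fun [set: euclidean R n] g ->
    {ae @lebesgue R n, forall x, `|g x| <= `|f x|} ->
    bbs_mem g /\ bbs_norm g <= bbs_norm f ;
  (* the limit F may a priori take the value +oo *)
  bbs_fatou : forall (u : nat -> euclidean R n -> R)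
      (F : euclidean R n -> \bar R),
    (forall k, bbs_mem (u k)) ->
    {ae @lebesgue R n, forall x, [/\ forall k, 0 <= u k x,
      nondecreasing_seq (u ^~ x) & (u k x)%:E @[k --> \oo] --> F x]} ->
    has_ubound (range (fun k => bbs_norm (u k))) ->
    exists f, [/\ bbs_mem f, {ae @lebesgue R n, forall x, F x = (f x)%:E} &
      bbs_norm f = sup (range (fun k => bbs_norm (u k)))] ;
  bbs_ball : forall (c : euclidean R n) (r : R), 0 < r ->
    bbs_mem \1_(euclidean_ball c r) ;
  bbs_integrable : forall (c : euclidean R n) (r : R), 0 < r ->
    exists C : R, forall f, bbs_mem f ->
      (\int[@lebesgue R n]_(x in euclidean_ball c r) `|f x|%:E
        <= (C * bbs_norm f)%:E)%E }.

(* The norm of an extended-valued function: all real-valued f in X that are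
   a.e. equal to F have the same norm, and the infimum is +oo if there is
   no such f. *)
Definition bbs_enorm (R : realType) (n : nat) (X : ballBanachSpace R n)
    (F : euclidean R n -> \bar R) : \bar R :=
  ereal_inf [set (bbs_norm X f)%:E | f in [set f | bbs_mem X f /\
    {ae @lebesgue R n, forall x, F x = (f x)%:E}]].

Lemma bbs_enormE (R : realType) (n : nat) (X : ballBanachSpace R n) f F :
  bbs_mem X f -> {ae @lebesgue R n, forall x, F x = (f x)%:E} ->
  bbs_enorm X F = (bbs_norm X f)%:E.
Proof.
move=> Xf Ff; rewrite /bbs_enorm.
rewrite (_ : [set _ | _ in _] = [set (bbs_norm X f)%:E]) ?ereal_inf1//.
apply/seteqP; split => [y [g [Xg Fg] <-{y}]|y ->{y}]; last by exists f.
have fg : {ae @lebesgue R n, forall x, f x = g x}.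
  by apply: filterS2 Ff Fg => x -> [].
by have [_ ->] := bbs_ae_eq Xf fg.
Qed.

Lemma bbs_enorm_notin (R : realType) (n : nat) (X : ballBanachSpace R n) F :
  ~ (exists2 f, bbs_mem X f & {ae @lebesgue R n, forall x, F x = (f x)%:E}) ->
  bbs_enorm X F = +oo%E.
Proof.
move=> nF; rewrite /bbs_enorm (_ : [set _ | _ in _] = set0) ?ereal_inf0//.
by apply/seteqP; split => [y [f [Xf Ff] _]|//]; apply: nF; exists f.
Qed.

Definition average (R : realType) (n : nat) (f : euclidean R n -> R)
    (Q : set (euclidean R n)) : \bar R :=
  (((fine (lebesgue Q))^-1)%:E * \int[@lebesgue R n]_(x in Q) (f x)%:E)%E.

(* half-open cubes; closed or open ones give the same function *)
Definition maximal (R : realType) (n : nat) (f : euclidean R n -> R)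
    (x : euclidean R n) : \bar R :=
  ereal_sup [set ((\1_Q x)%:E * average (fun y => `|f y|)%R Q)%E |
    Q in @is_cube R n].

Definition sparse_operator (R : realType) (n : nat)
    (S : set (set (euclidean R n))) (f : euclidean R n -> R)
    (x : euclidean R n) : \bar R :=
  (\sum_(Q \in S) average (fun y => `|f y|)%R Q * (\1_Q x)%:E)%E.

Definition lq_sum (R : realType) (n N : nat) (q : R)
    (F : 'I_N -> euclidean R n -> \bar R) (x : euclidean R n) : \bar R :=
  ((\sum_(j < N) F j x `^ q) `^ q^-1)%E.

Definition dyadic_grid (R : realType) (n : nat)
    (D : set (set (euclidean R n))) : Prop :=
  exists Dk : int -> set (set (euclidean R n)),
    [/\ D = \bigcup_k Dk k,
        forall k, partition (Dk k) id setT /\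
          (forall Q, Dk k Q -> exists a, Q = cube a (2 ^ (- k))),
        forall k Q, Dk k Q -> exists! P, Dk (k - 1) P /\ Q `<=` P,
        forall k Q, Dk k Q -> exists E : set (set (euclidean R n)),
          [/\ E `<=` Dk (k + 1), (E #= `I_(2 ^ n))%card & partition E id Q] &
        forall P Q, D P -> D Q -> [\/ P `&` Q = set0, P `<=` Q | Q `<=` P]].

Definition sparse (R : realType) (n : nat) (eta : R)
    (S : set (set (euclidean R n))) : Prop :=
  exists E : set (euclidean R n) -> set (euclidean R n),
    trivIset S E /\
    forall Q, S Q -> [/\ measurable (E Q), E Q `<=` Q &
      (eta%:E * lebesgue Q <= lebesgue (E Q))%E].

Definition Gamma_const (R : realType) (q : R) (m : nat) : R :=
  let q' := q / (q - 1) in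
  (limn (fun N : nat => \sum_(1 <= l < N.+1)
    ('C(l + m - 2, m - 1)%:R : R) `^ (- (q - 1)^-1))) `^ q'^-1.

(* Main.v *)
(* Fix a point x. The cubes of S that contain x form a chain
   Q_1 <= ... <= Q_K for inclusion, and Q_l is the top of
   b_l = binomial(l + m - 2, m - 1) decreasing chains of length m in S whose
   cubes all contain x. By Hoelder, with weights b_l,
     sum_l <f>_{Q_l} <= Gamma_{q,m} (sum_l b_l <f>_{Q_l}^q)^{1/q},
   and the last sum is dominated by the l^q-sum of the family obtained from f
   by applying m times the step (g_j)_j |-> (<g_j>_Q 1_Q)_{j, Q in S}.
   Each step costs a factor C^2 / eta in the X-norm of the l^q-sum: the maximal
   inequality is applied to (g_j), which controls (<g_j>_Q 1_{E_Q}), and then to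
   (<g_j>_Q 1_{E_Q}), since M(1_{E_Q}) >= eta on Q. *)

Require Import Defs.
From mathcomp Require Import all_boot all_order all_algebra.
From mathcomp Require Import all_classical all_reals all_analysis.
From mathcomp Require Import finmap measurable_realfun ring.

Set Implicit Arguments.
Unset Strict Implicit.

Import Order.TTheory GRing.Theory Num.Theory.
Import numFieldNormedType.Exports.

Local Open Scope classical_set_scope.
Local Open Scope ring_scope.

(** * Hölder's inequality for finite sums and the binomial series in [Gamma_const] *)

(** The inductive step of Hölder's inequality: the two-term case for the pairs a, A^(1/p) and b,
    B^(1/q). *)
Lemma hoelder_cons (R : realType) (a b A B p q : R) : 0 <= a -> 0 <= b ->
  0 <= A -> 0 <= B -> 0 < p -> 0 < q -> p^-1 + q^-1 = 1 ->
  a * b + A `^ p^-1 * B `^ q^-1 <=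
  (a `^ p + A) `^ p^-1 * (b `^ q + B) `^ q^-1.
Proof.
move=> a0 b0 A0 B0 p0 q0 pq.
have := hoelder2 a0 (powR_ge0 A p^-1) b0 (powR_ge0 B q^-1) p0 q0 pq.
by rewrite -[(A `^ _) `^ _]powRrM -[(B `^ _) `^ _]powRrM !mulVf ?gt_eqF// !powRr1.
Qed.

Lemma hoelder_sum (R : realType) (I : Type) (s : seq I) (a b : I -> R)
    (p q : R) : (forall i, 0 <= a i) -> (forall i, 0 <= b i) ->
  0 < p -> 0 < q -> p^-1 + q^-1 = 1 ->
  \sum_(i <- s) a i * b i <=
  (\sum_(i <- s) a i `^ p) `^ p^-1 * (\sum_(i <- s) b i `^ q) `^ q^-1.
Proof.
move=> a0 b0 p0 q0 pq; elim: s => [|i s IH].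
  by rewrite !big_nil mulr_ge0 ?powR_ge0.
rewrite !big_cons (le_trans (lerD (lexx _) IH))//.
by apply: hoelder_cons => //; apply: sumr_ge0 => j _; exact: powR_ge0.
Qed.

(* With x = k + 2, this is ln (1 - 1/x) <= - 1/x, multiplied by - t and
   exponentiated. *)
Lemma powRN_telescope (R : realType) (t : R) (k : nat) : 0 < t ->
  t * k.+2%:R `^ (- (t + 1)) <= k.+1%:R `^ (- t) - k.+2%:R `^ (- t).
Proof.
move=> t0; set x : R := k.+2%:R; have x0 : 0 < x by rewrite ltr0n.
have xm : k.+1%:R = x * (1 - x^-1) :> R.
  by rewrite mulrBr mulr1 divff ?gt_eqF// /x -[k.+2]addn1 natrD addrK.
have y0 : 0 < 1 - x^-1 by rewrite subr_gt0 invf_lt1// /x ltr1n.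
rewrite xm (powRM _ (ltW x0) (ltW y0)) opprD powRD; last first.
  by apply/implyP => _; rewrite gt_eqF.
rewrite (powR_inv1 (ltW x0)) mulrCA -{3}[x `^ (- t)]mulr1 -mulrBr.
rewrite ler_wpM2l ?powR_ge0// /powR gt_eqF// lerBrDl.
rewrite (le_trans _ (expR_ge1Dx _))// lerD2l mulNr -mulrN (ler_wpM2l (ltW t0))//.
by rewrite lerNr le_ln1Dx// ltrN2 invf_lt1// /x ltr1n.
Qed.

Lemma riemann_sum_le (R : realType) (s : R) (N : nat) : 1 < s ->
  \sum_(0 <= k < N) k.+1%:R `^ (- s) <= 1 + (s - 1)^-1.
Proof.
move=> s1; have t0 : 0 < s - 1 by rewrite subr_gt0.
case: N => [|N]; first by rewrite big_nil addr_ge0 ?invr_ge0 ?ltW.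
(* The bound is sharpened to 1 plus the integral of x^(-s) over [1, N + 1], so that an induction on
   N telescopes. *)
suff : \sum_(0 <= k < N.+1) k.+1%:R `^ (- s) <=
    1 + (s - 1)^-1 * (1 - N.+1%:R `^ (- (s - 1))).
  move/le_trans; apply; rewrite lerD2l ler_piMr ?invr_ge0 ?(ltW t0)//.
elim: N => [|N IH]; first by rewrite big_nat1 !powR1 subrr mulr0 addr0.
rewrite big_nat_recr//= (le_trans (lerD IH (lexx _)))//.
rewrite -addrA lerD2l -lerBrDl -mulrBr.
rewrite [X in _ * X](_ : _ =
  N.+1%:R `^ (- (s - 1)) - N.+2%:R `^ (- (s - 1))); last by ring.
rewrite -(ler_pM2l t0) mulrA divff ?gt_eqF// mul1r; have := powRN_telescope N t0.
by rewrite subrK.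
Qed.

(** The right-hand side is the product (k + 1)...(k + p), whose p factors are all at least k + 1. *)
Lemma exp_le_fact_bin (k p : nat) : (k.+1 ^ p <= p`! * 'C(k + p, p))%N.
Proof.
rewrite mulnC bin_ffact; elim: p => // p IH.
by rewrite addnS ffactSS expnS leq_mul// ltnS leq_addr.
Qed.

(** By [exp_le_fact_bin], each term is at most p!^r (k + 1)^(-pr), and these powers are summable
    since pr > 1. *)
Lemma Gamma_series_le (R : realType) (r : R) (p N : nat) : 0 < r -> 1 < p%:R * r ->
  \sum_(0 <= k < N) 'C(k + p, p)%:R `^ (- r) <=
  p`!%:R `^ r * (1 + (p%:R * r - 1)^-1).
Proof.
move=> r0 pr1.
rewrite (le_trans _ (ler_wpM2l (powR_ge0 _ _) (riemann_sum_le N pr1)))//.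
rewrite mulr_sumr ler_sum// => k _; set b : R := _%:R.
have b0 : 0 < b by rewrite ltr0n bin_gt0 leq_addl.
have f0 : (0 : R) < p`!%:R by rewrite ltr0n fact_gt0.
rewrite !powRN powRrM powR_mulrn// ler_pdivlMr ?powR_gt0//.
rewrite ler_pdivrMl ?powR_gt0// mulrC -(powRM _ (ltW f0) (ltW b0)).
rewrite ge0_ler_powR ?nnegrE ?exprn_ge0 ?mulr_ge0 ?(ltW r0, ltW b0, ltW f0)//.
by rewrite -natrX -natrM ler_nat exp_le_fact_bin.
Qed.

Lemma bin_hockey_stick (k i : nat) :
  (\sum_(0 <= j < i.+1) 'C(j + k, k) = 'C(i + k.+1, k.+1))%N.
Proof.
elim: i => [|i IH]; first by rewrite big_nat1 !add0n !binn.
by rewrite big_nat_recr//= IH [(i.+1 + k.+1)%N]addSn binS addSnnS.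
Qed.

(** The series converges because q < p + 1 gives p / (q - 1) > 1, so its limit bounds the increasing
    partial sums. *)
Lemma Gamma_const_ge (R : realType) (q : R) (p K : nat) :
  1 < q -> q < p.+1%:R ->
  (\sum_(0 <= k < K) 'C(k + p, p)%:R `^ (- (q - 1)^-1)) `^ (q / (q - 1))^-1
  <= Gamma_const q p.+1.
Proof.
move=> q1 qp; have t0 : 0 < q - 1 by rewrite subr_gt0.
pose u N : R := \sum_(0 <= k < N) 'C(k + p, p)%:R `^ (- (q - 1)^-1).
(* With l = k + 1 and m = p + 1, the index l + m - 2 becomes k + p. *)
have uE : (fun N : nat => \sum_(1 <= l < N.+1)
    ('C(l + p.+1 - 2, p.+1 - 1)%:R : R) `^ (- (q - 1)^-1)) = u.
  apply/funext => N; rewrite /u big_add1/=; apply: eq_bigr => k _.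
  by rewrite subn1/= addSn addnS subn2.
have u_nd : nondecreasing_seq u.
  by apply/nondecreasing_seqP => N; rewrite /u big_nat_recr//= lerDl powR_ge0.
have u_cvg : cvgn u.
  apply: nondecreasing_is_cvgn => //.
  exists (p`!%:R `^ (q - 1)^-1 * (1 + (p%:R * (q - 1)^-1 - 1)^-1)) => _ [N _ <-].
  apply: Gamma_series_le; first by rewrite invr_gt0.
  by rewrite ltr_pdivlMr// mul1r ltrBlDr natr1.
have uK := nondecreasing_cvgn_le u_nd u_cvg K.
have u0 : 0 <= u K by apply: sumr_ge0 => k _; exact: powR_ge0.
rewrite /Gamma_const uE ge0_ler_powR ?nnegrE ?(le_trans u0 uK)//.
by rewrite invr_ge0 divr_ge0 ?(ltW t0)// (le_trans ler01) ?ltW.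
Qed.

(** Hölder with exponents q' and q for a_k = b_k^(-1/q) (b_k^(1/q) a_k), where b_k is the binomial
    coefficient and q' / q = 1 / (q - 1). *)
Lemma sum_le_Gamma_const (R : realType) (q : R) (p K : nat) (a : nat -> R) :
  1 < q -> q < p.+1%:R -> (forall k, 0 <= a k) ->
  \sum_(0 <= k < K) a k <= Gamma_const q p.+1 *
    (\sum_(0 <= k < K) 'C(k + p, p)%:R * a k `^ q) `^ q^-1.
Proof.
move=> q1 qp a0; have q0 : 0 < q by rewrite (lt_trans ltr01).
have t0 : 0 < q - 1 by rewrite subr_gt0.
have b0 k : (0 : R) < 'C(k + p, p)%:R by rewrite ltr0n bin_gt0 leq_addl.
pose b k : R := 'C(k + p, p)%:R.
have := @hoelder_sum R nat (index_iota 0 K) (fun k => b k `^ (- q^-1))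
  (fun k => b k `^ q^-1 * a k) (q / (q - 1)) q.
have -> : \sum_(0 <= k < K) b k `^ (- q^-1) * (b k `^ q^-1 * a k) =
    \sum_(0 <= k < K) a k.
  apply: eq_bigr => k _.
  by rewrite mulrA powRN mulVf ?mul1r// gt_eqF// powR_gt0// b0.
have -> : \sum_(0 <= k < K) (b k `^ (- q^-1)) `^ (q / (q - 1)) =
    \sum_(0 <= k < K) b k `^ (- (q - 1)^-1).
  apply: eq_bigr => k _; rewrite -powRrM; congr (_ `^ _).
  by rewrite mulNr mulrA mulVf ?mul1r// gt_eqF.
have -> : \sum_(0 <= k < K) (b k `^ q^-1 * a k) `^ q =
    \sum_(0 <= k < K) b k * a k `^ q.
  apply: eq_bigr => k _; rewrite powRM ?powR_ge0// -powRrM mulVf ?gt_eqF//.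
  by rewrite powRr1// ltW// b0.
move=> H; apply: le_trans (H _ _ _ _ _) _ => //.
- by move=> k; rewrite powR_ge0.
- by move=> k; rewrite mulr_ge0 ?powR_ge0.
- by rewrite divr_gt0.
- by field; rewrite !gt_eqF.
- by rewrite ler_wpM2r ?powR_ge0//; exact: Gamma_const_ge.
Qed.

(** * Cubes, averages and the maximal function *)

Lemma measurable_cube (R : realType) (n : nat) (c : euclidean R n) (l : R) :
  measurable (cube c l).
Proof.
apply: sub_caratheodory; apply: sub_sigma_algebra.
rewrite (_ : cube c l = \bigcap_(i in [set: 'I_n])
  ((fun t : n.-tuple (measurableTypeR R) => tnth t i) @^-1`
    `[coordinate c i, coordinate c i + l[%classic)).
  apply: fin_bigcap_measurable; first exact: finite_finset.
  move=> i _; rewrite -[X in measurable X]setTI.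
  by apply: measurable_tnth => //; exact: measurable_itv.
apply/seteqP; split => t /=.
  by move=> H i _; have := H i; rewrite /= in_itv.
by move=> H i; have := H i I; rewrite /= in_itv.
Qed.

Lemma measurable_is_cube (R : realType) (n : nat) (Q : set (euclidean R n)) :
  is_cube Q -> measurable Q.
Proof. by move=> [c [l [_ ->]]]; exact: measurable_cube. Qed.

Lemma lebesgue_is_cube (R : realType) (n : nat) (Q : set (euclidean R n)) :
  is_cube Q -> exists2 v : R, 0 < v & lebesgue Q = v%:E.
Proof.
by move=> [c [l [l0 ->]]]; exists (l ^+ n); rewrite ?exprn_gt0// lebesgue_cube.
Qed.

Lemma cube_sub_ball (R : realType) (n : nat) (Q : set (euclidean R n)) :
  is_cube Q -> exists (c : euclidean R n) (r : R),
    0 < r /\ Q `<=` euclidean_ball c r.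
Proof.
(* The radius is the diagonal of the cube plus 1, which makes the inequality defining the ball
   strict. *)
move=> [c [l [l0 ->]]]; exists c, (Num.sqrt (\sum_(i < n) l ^+ 2) + 1).
split=> [|x cx]; first by rewrite ltr_wpDl ?sqrtr_ge0.
rewrite /euclidean_ball/= ltr_pwDr// ler_sqrt ?ler_sum//.
  move=> i _; have /andP[ax xa] := cx i.
  rewrite ler_sqr ?nnegrE ?subr_ge0 ?(ltW l0)//.
  by rewrite lerBlDl ltW.
by rewrite sumr_ge0// => i _; rewrite exprn_ge0// ltW.
Qed.

Lemma average_ge0 (R : realType) (n : nat) (f : euclidean R n -> R)
    (Q : set (euclidean R n)) :
  is_cube Q -> (0 <= average (fun y => `|f y|)%R Q)%E.
Proof.
move=> /lebesgue_is_cube[v v0 Qv]; rewrite /average Qv/= mule_ge0//.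
  by rewrite lee_fin invr_ge0 ltW.
by apply: integral_ge0 => x _; rewrite lee_fin.
Qed.

(** A ball containing the cube reduces the claim to the local integrability of members of X. *)
Lemma average_fin_num (R : realType) (n : nat) (X : ballBanachSpace R n)
    (f : euclidean R n -> R) (Q : set (euclidean R n)) :
  bbs_mem X f -> is_cube Q -> average (fun y => `|f y|) Q \is a fin_num.
Proof.
move=> Xf cQ; have [c [r [r0 Qr]]] := cube_sub_ball cQ.
have [C HC] := bbs_integrable X c r0.
(* The ball is measurable because its indicator belongs to X. *)
have mB : measurable (euclidean_ball c r).
  by apply/(@measurable_indicP _ _ R); exact: bbs_measurable (bbs_ball X c r0).
rewrite /average fin_numM// ge0_fin_numE.
  rewrite (le_lt_trans _ (ltry (C * bbs_norm X f)))// (le_trans _ (HC _ Xf))//.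
  apply: ge0_subset_integral.
  - exact: measurable_is_cube.
  - exact: mB.
  - apply/measurable_EFinP/measurableT_comp; first exact: normr_measurable.
    exact: measurable_funS (bbs_measurable Xf).
  - by move=> x _; rewrite lee_fin.
  - exact: Qr.
by apply: integral_ge0 => x _; rewrite lee_fin.
Qed.

Lemma average_indic (R : realType) (n : nat) (c : R)
    (A Q : set (euclidean R n)) : 0 <= c -> measurable A -> is_cube Q ->
  average (fun y => `|c * \1_A y|) Q =
  (((fine (lebesgue Q))^-1)%:E * (c%:E * lebesgue (A `&` Q)))%E.
Proof.
move=> c0 mA cQ; have mQ := measurable_is_cube cQ.
rewrite /average; congr (_ * _)%E.
under eq_integral => y _.
  rewrite normrM (ger0_norm c0) (@ger0_norm _ (\1_A y))// EFinM; over.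
rewrite ge0_integralZl_EFin.
- by rewrite integral_indic.
- exact: mQ.
- by move=> y _; rewrite lee_fin.
- by apply/measurable_EFinP; exact: measurable_indic.
- exact: c0.
Qed.

Lemma average_indic_sub (R : realType) (n : nat) (c : R)
    (A Q : set (euclidean R n)) : 0 <= c -> measurable A -> is_cube Q ->
  Q `<=` A -> average (fun y => `|c * \1_A y|) Q = c%:E.
Proof.
move=> c0 mA cQ QA; rewrite average_indic// setIidr//.
have [v v0 ->] := lebesgue_is_cube cQ.
by rewrite /= -!EFinM mulrCA mulVf ?mulr1// gt_eqF.
Qed.

Lemma average_le_maximal (R : realType) (n : nat) (f : euclidean R n -> R)
    (Q : set (euclidean R n)) (x : euclidean R n) : is_cube Q -> Q x ->
  (average (fun y => `|f y|)%R Q <= maximal f x)%E.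
Proof.
move=> cQ Qx; apply: ereal_sup_ubound; exists Q => //.
by rewrite indicE mem_set// mul1e.
Qed.

Lemma maximal_ge0 (R : realType) (n : nat) (f : euclidean R n -> R)
    (x : euclidean R n) : (0 <= maximal f x)%E.
Proof.
have cQ : is_cube (cube x 1) by exists x, 1.
apply: le_trans (average_ge0 _ cQ) (average_le_maximal f cQ _).
by move=> i; rewrite lexx ltrDl ltr01.
Qed.

(** * Pointwise l^q-norms of finite families *)

(** Real-valued counterpart of [lq_sum]. Families are lists, so that they can be concatenated and
    repeated members count with multiplicity. *)
Definition lq_norm (R : realType) (n : nat) (q : R)
    (F : seq (euclidean R n -> R)) (x : euclidean R n) : R :=
  (\sum_(g <- F) `|g x| `^ q) `^ q^-1.

Lemma lq_norm_ge0 (R : realType) (n : nat) (q : R)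
    (F : seq (euclidean R n -> R)) (x : euclidean R n) : 0 <= lq_norm q F x.
Proof. exact: powR_ge0. Qed.

Lemma sum_powR_ge0 (R : realType) (n : nat) (q : R)
    (F : seq (euclidean R n -> R)) (x : euclidean R n) :
  0 <= \sum_(g <- F) `|g x| `^ q.
Proof. by apply: sumr_ge0 => g _; exact: powR_ge0. Qed.

Lemma measurable_lq_norm (R : realType) (n : nat) (q : R)
    (F : seq (euclidean R n -> R)) :
  (forall g, g \in F -> measurable_fun [set: euclidean R n] g) ->
  measurable_fun [set: euclidean R n] (lq_norm q F).
Proof.
move=> mF; apply: (measurableT_comp (@measurable_powR R _)).
elim: F mF => [|g F IH] mF.
  by under eq_fun do rewrite big_nil; exact: measurable_cst.
under eq_fun do rewrite big_cons.
apply: measurable_funD; last by apply: IH => h hF; apply: mF; rewrite inE hF orbT.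
apply: (measurableT_comp (@measurable_powR R _)).
apply: measurableT_comp; first exact: normr_measurable.
by apply: mF; rewrite inE eqxx.
Qed.

Lemma mem_le_lq_norm (R : realType) (n : nat) (q : R)
    (F : seq (euclidean R n -> R)) (g : euclidean R n -> R)
    (x : euclidean R n) : 0 < q -> g \in F -> `|g x| <= lq_norm q F x.
Proof.
move=> q0 gF; rewrite -[leLHS]powRr1// -(@mulfV _ q) ?gt_eqF// powRrM.
rewrite /lq_norm ge0_ler_powR ?nnegrE ?invr_ge0 ?(ltW q0) ?powR_ge0//.
  exact: sum_powR_ge0.
by rewrite (big_rem g gF)/= lerDl; exact: sum_powR_ge0.
Qed.

(** * The vector-valued maximal inequality *)

Definition maximal_bounded (R : realType) (n : nat) (X : ballBanachSpace R n)
    (q C : R) : Prop :=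
  forall (N : nat) (f : 'I_N -> euclidean R n -> R),
    (forall j, measurable_fun [set: euclidean R n] (f j)) ->
    (bbs_enorm X (lq_sum q (fun j x => `|f j x|%:E)) < +oo)%E ->
    (bbs_enorm X (lq_sum q (fun j => maximal (f j))) <=
      C%:E * bbs_enorm X (lq_sum q (fun j x => `|f j x|%:E)))%E.

(* Measurability of the maximal functions is never needed: finiteness of the
   norm provides an element of X that is almost everywhere equal to their
   l^q-sum. *)
Lemma maximal_dominates (R : realType) (n : nat) (X : ballBanachSpace R n)
    (q C : R) (F G : seq (euclidean R n -> R)) :
  maximal_bounded X q C -> 0 < q ->
  (forall g, g \in F -> measurable_fun [set: euclidean R n] g) ->
  (forall g, g \in G -> measurable_fun [set: euclidean R n] g) ->
  (forall x, ((\sum_(g <- G) `|g x| `^ q)%:E <=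
    \sum_(g <- F) maximal g x `^ q)%E) ->
  bbs_mem X (lq_norm q F) ->
  bbs_mem X (lq_norm q G) /\
  bbs_norm X (lq_norm q G) <= C * bbs_norm X (lq_norm q F).
Proof.
move=> MB q0 mF mG GF XF.
pose f (j : 'I_(size F)) := nth (fun=> 0) F j.
have mf j : measurable_fun [set: euclidean R n] (f j) by apply: mF; exact: mem_nth.
have fE : bbs_enorm X (lq_sum q (fun j x => `|f j x|%:E)) =
    (bbs_norm X (lq_norm q F))%:E.
  apply: bbs_enormE => //; apply: aeW => x.
  rewrite /lq_sum /lq_norm (big_nth (fun=> 0)) big_mkord -poweR_EFin -sumEFin.
  by congr (_ `^ _)%E; apply: eq_bigr => j _; rewrite poweR_EFin.
have := MB _ f mf; rewrite fE => /(_ (ltry _)).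
have [[h Xh hE]|nh] := pselect (exists2 h, bbs_mem X h &
  {ae @lebesgue R n, forall x, lq_sum q (fun j => maximal (f j)) x = (h x)%:E});
  last by rewrite bbs_enorm_notin// -EFinM leye_eq.
rewrite (bbs_enormE Xh hE) -EFinM lee_fin => hC.
have [XG Gh] : bbs_mem X (lq_norm q G) /\
    bbs_norm X (lq_norm q G) <= bbs_norm X h.
  apply: (bbs_ideal Xh (measurable_lq_norm _ mG)).
  apply: filterS hE => x hx; rewrite (ger0_norm (lq_norm_ge0 _ _ _)).
  rewrite (le_trans _ (ler_norm _))// -lee_fin -hx /lq_sum /lq_norm -poweR_EFin.
  have -> : (\sum_(j < size F) maximal (f j) x `^ q =
      \sum_(g <- F) maximal g x `^ q)%E by rewrite (big_nth (fun=> 0)) big_mkord.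
  apply: gt0_ler_poweR; rewrite ?invr_ge0 ?(ltW q0)// ?in_itv/= ?leey ?andbT.
  - by rewrite lee_fin sum_powR_ge0.
  - by rewrite sume_ge0// => g _; exact: poweR_ge0.
split=> //; exact: le_trans hC.
Qed.

(** * Norm bounds for averaging over a sparse family, once and repeatedly *)

(** For members of X the averages over cubes are finite, so [fine] does not change them. *)
Definition favg (R : realType) (n : nat) (f : euclidean R n -> R)
    (Q : set (euclidean R n)) : R :=
  fine (average (fun y => `|f y|) Q).

Definition scaled_indic (R : realType) (n : nat) (c : R)
    (A : set (euclidean R n)) (x : euclidean R n) : R := c * \1_A x.

(** One function is kept per pair of g and Q, so the k-th iterate on a single function is a list
    indexed by k-tuples of cubes, in which chains can be counted. *)
Definition sparse_step (R : realType) (n : nat) (s : seq (set (euclidean R n)))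
    (F : seq (euclidean R n -> R)) : seq (euclidean R n -> R) :=
  [seq scaled_indic (favg g Q) Q | g <- F, Q <- s].

Lemma favg_ge0 (R : realType) (n : nat) (f : euclidean R n -> R)
    (Q : set (euclidean R n)) : is_cube Q -> 0 <= favg f Q.
Proof. by move=> cQ; rewrite fine_ge0// average_ge0. Qed.

Lemma favg_indic_sub (R : realType) (n : nat) (c : R)
    (A Q : set (euclidean R n)) : 0 <= c -> measurable A -> is_cube Q ->
  Q `<=` A -> favg (scaled_indic c A) Q = c.
Proof. by move=> *; rewrite /favg average_indic_sub. Qed.

Lemma measurable_scaled_indic (R : realType) (n : nat) (c : R)
    (A : set (euclidean R n)) : measurable A ->
  measurable_fun [set: euclidean R n] (scaled_indic c A).
Proof.
move=> mA; apply: measurable_funM; first exact: measurable_cst.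
exact: measurable_indic.
Qed.

Lemma scaled_indic_in (R : realType) (n : nat) (c : R)
    (A : set (euclidean R n)) (x : euclidean R n) :
  A x -> scaled_indic c A x = c.
Proof. by move=> Ax; rewrite /scaled_indic indicE mem_set// mulr1. Qed.

Lemma scaled_indic_notin (R : realType) (n : nat) (c : R)
    (A : set (euclidean R n)) (x : euclidean R n) :
  ~ A x -> scaled_indic c A x = 0.
Proof. by move=> Ax; rewrite /scaled_indic indicE memNset// mulr0. Qed.

Lemma measurable_sparse_step (R : realType) (n : nat)
    (s : seq (set (euclidean R n))) (F : seq (euclidean R n -> R)) :
  (forall Q, Q \in s -> is_cube Q) ->
  forall g, g \in sparse_step s F -> measurable_fun [set: euclidean R n] g.
Proof.
move=> cs g /allpairsP[[h Q] /= [_ Qs ->]].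
exact: measurable_scaled_indic (measurable_is_cube (cs _ Qs)).
Qed.

(** By disjointness of the sets [E Q], at most one term is nonzero at x, and it comes from an
    average over a cube containing x. *)
Lemma sparse_sum_le_maximal (R : realType) (n : nat) (X : ballBanachSpace R n)
    (q : R) (s : seq (set (euclidean R n)))
    (E : set (euclidean R n) -> set (euclidean R n)) (g : euclidean R n -> R)
    (x : euclidean R n) :
  0 < q -> uniq s -> (forall Q, Q \in s -> is_cube Q) ->
  (forall Q, Q \in s -> E Q `<=` Q) ->
  (forall P Q, P \in s -> Q \in s -> E P x -> E Q x -> P = Q) ->
  bbs_mem X g ->
  ((\sum_(Q <- s) `|scaled_indic (favg g Q) (E Q) x| `^ q)%:E <=
    maximal g x `^ q)%E.
Proof.
move=> q0 us cs Es Edisj Xg.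
have [[Q [Qs EQx]]|nE] := pselect (exists Q, Q \in s /\ E Q x).
  have cQ := cs _ Qs; rewrite (bigD1_seq Q)//= [X in _ + X]big1_seq ?addr0.
    rewrite scaled_indic_in// -poweR_EFin ger0_norm ?favg_ge0//.
    rewrite fineK ?(average_fin_num Xg)//.
    apply: gt0_ler_poweR; rewrite ?(ltW q0)// ?in_itv/= ?leey ?andbT ?maximal_ge0//.
      exact: average_ge0.
    by apply: average_le_maximal => //; exact: Es EQx.
  move=> P /andP[PQ Ps]; rewrite scaled_indic_notin ?normr0 ?powR0 ?gt_eqF//.
  by move=> EPx; move/eqP : PQ; apply; exact: Edisj.
rewrite big1_seq ?poweR_ge0// => Q /= Qs.
rewrite scaled_indic_notin ?normr0 ?powR0 ?gt_eqF//.
by move=> EQx; apply: nE; exists Q.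
Qed.

(** Testing the maximal function on Q itself gives c |E| / |Q|, which is at least eta c. *)
Lemma sparse_le_maximal (R : realType) (n : nat) (eta c : R)
    (E Q : set (euclidean R n)) (x : euclidean R n) : 0 <= c -> measurable E ->
  is_cube Q -> E `<=` Q -> (eta%:E * lebesgue Q <= lebesgue E)%E ->
  ((scaled_indic (eta * c) Q x)%:E <= maximal (scaled_indic c E) x)%E.
Proof.
move=> c0 mE cQ EQ etaE.
have [Qx|Qx] := pselect (Q x); last by rewrite scaled_indic_notin ?maximal_ge0.
rewrite scaled_indic_in//.
apply: (le_trans _ (average_le_maximal _ cQ Qx)).
rewrite average_indic// setIidl//.
have [v v0 Qv] := lebesgue_is_cube cQ; rewrite Qv/= in etaE *.
have -> : (eta * c)%:E = (v^-1%:E * (c%:E * (eta%:E * v%:E)))%E.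
  by rewrite -!EFinM; congr EFin; field; rewrite gt_eqF.
by rewrite lee_wpmul2l ?lee_fin ?invr_ge0 ?(ltW v0)// lee_wpmul2l// lee_fin.
Qed.

Lemma sparse_step_bounded (R : realType) (n : nat) (X : ballBanachSpace R n)
    (q C eta : R) (s : seq (set (euclidean R n)))
    (E : set (euclidean R n) -> set (euclidean R n))
    (F : seq (euclidean R n -> R)) :
  maximal_bounded X q C -> 0 < q -> 0 <= C -> 0 < eta ->
  uniq s -> (forall Q, Q \in s -> is_cube Q) ->
  trivIset [set` s] E ->
  (forall Q, Q \in s -> [/\ measurable (E Q), E Q `<=` Q &
     (eta%:E * lebesgue Q <= lebesgue (E Q))%E]) ->
  (forall g, g \in F -> measurable_fun [set: euclidean R n] g) ->
  bbs_mem X (lq_norm q F) ->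
  bbs_mem X (lq_norm q (sparse_step s F)) /\
  bbs_norm X (lq_norm q (sparse_step s F)) <=
    eta^-1 * C ^+ 2 * bbs_norm X (lq_norm q F).
Proof.
move=> MB q0 C0 eta0 us cs tE sE mF XF.
(* Each |g| is at most the l^q-norm of the family, so g lies in X by the ideal property and has
   finite averages. *)
have XFg g : g \in F -> bbs_mem X g.
  move=> gF; have [] // := bbs_ideal XF (mF _ gF) _.
  apply: aeW => x; rewrite (le_trans (mem_le_lq_norm _ q0 gF))//.
  exact: ler_norm.
(* First application of the maximal inequality: each cube is shrunk to its set [E Q]. *)
pose H := [seq scaled_indic (favg g Q) (E Q) | g <- F, Q <- s].
have mH g : g \in H -> measurable_fun [set: euclidean R n] g.
  move=> /allpairsP[[h Q] /= [_ Qs ->]].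
  by have [mE _ _] := sE _ Qs; exact: measurable_scaled_indic.
have [XH HF] : bbs_mem X (lq_norm q H) /\
    bbs_norm X (lq_norm q H) <= C * bbs_norm X (lq_norm q F).
  apply: (maximal_dominates MB q0 mF mH _ XF) => x.
  rewrite /H big_allpairs_dep -sumEFin big_seq [leRHS]big_seq.
  apply: lee_sum => g gF; apply: (sparse_sum_le_maximal q0 us cs).
  - by move=> Q /sE[].
  - by move=> P Q Ps Qs EP EQ; apply: tE => //; exists x.
  - exact: XFg.
(* Second application: the factor eta makes each member pointwise at most the maximal function of
   its counterpart in [H]. *)
pose G := [seq scaled_indic (eta * favg g Q) Q | g <- F, Q <- s].
have mG g : g \in G -> measurable_fun [set: euclidean R n] g.
  move=> /allpairsP[[h Q] /= [_ Qs ->]].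
  exact: measurable_scaled_indic (measurable_is_cube (cs _ Qs)).
have [XG GH] : bbs_mem X (lq_norm q G) /\
    bbs_norm X (lq_norm q G) <= C * bbs_norm X (lq_norm q H).
  apply: (maximal_dominates MB q0 mH mG _ XH) => x.
  rewrite /G /H !big_allpairs_dep -sumEFin; apply: lee_sum => g _.
  rewrite -sumEFin big_seq [leRHS]big_seq; apply: lee_sum => Q Qs.
  have [mE EQ etaE] := sE _ Qs; rewrite -poweR_EFin.
  have a0 := favg_ge0 g (cs _ Qs).
  rewrite ger0_norm ?mulr_ge0 ?(ltW eta0)//.
  apply: gt0_ler_poweR; rewrite ?(ltW q0)// ?in_itv/= ?leey ?andbT ?maximal_ge0//.
    by rewrite lee_fin !mulr_ge0// ltW.
  exact: sparse_le_maximal a0 mE (cs _ Qs) EQ etaE.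
(* Homogeneity removes eta again, which is where the factor eta^(-1) enters. *)
have GE : lq_norm q (sparse_step s F) = eta^-1 \*o lq_norm q G.
  apply/funext => x /=; rewrite /lq_norm /sparse_step /G !big_allpairs_dep.
  have -> : \sum_(g <- F) \sum_(Q <- s)
      `|scaled_indic (eta * favg g Q) Q x| `^ q =
    eta `^ q * \sum_(g <- F) \sum_(Q <- s)
      `|scaled_indic (favg g Q) Q x| `^ q.
    rewrite mulr_sumr; apply: eq_bigr => g _; rewrite mulr_sumr.
    apply: eq_bigr => Q _; rewrite -powRM ?(ltW eta0)//.
    by rewrite /scaled_indic -mulrA normrM (gtr0_norm eta0).
  rewrite powRM ?powR_ge0//; last first.
    by rewrite sumr_ge0// => g _; rewrite sumr_ge0// => Q _; rewrite powR_ge0.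
  by rewrite -powRrM mulfV ?gt_eqF// powRr1 ?(ltW eta0)// mulrA mulVf ?mul1r// gt_eqF.
rewrite GE; split; first exact: bbs_memZ.
rewrite bbs_normZ// ger0_norm ?invr_ge0 ?(ltW eta0)// -mulrA.
rewrite ler_wpM2l ?invr_ge0 ?(ltW eta0)// (le_trans GH)// expr2 -mulrA.
exact: ler_wpM2l.
Qed.

Lemma iter_sparse_step_bounded (R : realType) (n : nat)
    (X : ballBanachSpace R n) (q C eta : R) (s : seq (set (euclidean R n)))
    (E : set (euclidean R n) -> set (euclidean R n)) (f : euclidean R n -> R)
    (m : nat) :
  maximal_bounded X q C -> 0 < q -> 0 <= C -> 0 < eta ->
  uniq s -> (forall Q, Q \in s -> is_cube Q) ->
  trivIset [set` s] E ->
  (forall Q, Q \in s -> [/\ measurable (E Q), E Q `<=` Q &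
     (eta%:E * lebesgue Q <= lebesgue (E Q))%E]) ->
  bbs_mem X f ->
  bbs_mem X (lq_norm q (iter m (sparse_step s) [:: f])) /\
  bbs_norm X (lq_norm q (iter m (sparse_step s) [:: f])) <=
    (eta^-1 * C ^+ 2) ^+ m * bbs_norm X f.
Proof.
move=> MB q0 C0 eta0 us cs tE sE Xf.
elim: m => [|m [XI IH]].
  have fE : lq_norm q [:: f] = fun x => `|f x|.
    by apply/funext => x; rewrite /lq_norm big_seq1 -powRrM mulfV ?gt_eqF// powRr1.
  rewrite fE expr0 mul1r; apply: (bbs_ideal Xf).
    apply: measurableT_comp; first exact: normr_measurable.
    exact: bbs_measurable Xf.
  by apply: aeW => x; rewrite normr_id.
have mI g : g \in iter m (sparse_step s) [:: f] ->
    measurable_fun [set: euclidean R n] g.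
  (* Before any step the family is f alone; afterwards every member is a multiple of the indicator
     of a cube. *)
  case: m {XI IH} => [|m]; last exact: measurable_sparse_step.
  by rewrite inE => /eqP ->; exact: bbs_measurable Xf.
have [XS HS] := sparse_step_bounded MB q0 C0 eta0 us cs tE sE mI XI.
split; first exact: XS.
rewrite (le_trans HS)// [_ ^+ m.+1]exprS -[leRHS]mulrA; apply: ler_wpM2l => //.
by rewrite mulr_ge0 ?invr_ge0 ?exprn_ge0// ltW.
Qed.

(** * Nested cubes through a point and the counting of chains *)

(** Cubes containing x meet, so the dyadic alternative makes inclusion total on them, and sorting
    lists them from smallest to largest. *)
Lemma sorted_cubes_at (R : realType) (n : nat)
    (s : seq (set (euclidean R n))) (x : euclidean R n) :
  (forall P Q, P \in s -> Q \in s -> [\/ P `&` Q = set0, P `<=` Q | Q `<=` P]) ->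
  exists t : seq (set (euclidean R n)),
    perm_eq t [seq Q <- s | x \in Q] /\
    forall i j, (i <= j < size t)%N -> nth set0 t i `<=` nth set0 t j.
Proof.
move=> ds; pose le (P Q : set (euclidean R n)) := `[< P `<=` Q >].
have le_tr : transitive le.
  by move=> Q P T /asboolP PQ /asboolP QT; apply/asboolP; exact: subset_trans QT.
have le_refl : reflexive le by move=> Q; exact/asboolP.
exists (sort le [seq Q <- s | x \in Q]); split; first by rewrite perm_sort.
have le_tot : {in [pred Q | (Q \in s) && (x \in Q)] &, total le}.
  move=> P Q /= /andP[Ps /set_mem Px] /andP[Qs /set_mem Qx]; apply/orP.
  have [PQ0|PQ|QP] := ds _ _ Ps Qs; [|by left; apply/asboolP..|].
    by have : (P `&` Q) x by []; rewrite PQ0.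
  by right; apply/asboolP.
have srt : sorted le (sort le [seq Q <- s | x \in Q]).
  apply: (sort_sorted_in le_tot); apply/allP => Q.
  by rewrite mem_filter inE andbC.
move=> i j /andP[ij jt]; apply/asboolP.
by apply: (sorted_leq_nth le_tr le_refl set0 srt) => //; rewrite inE (leq_ltn_trans ij).
Qed.

(** A step acts on each member separately, hence commutes with concatenation. This lets the first
    step of an iteration be peeled off. *)
Lemma sum_iter_sparse_step (R : realType) (n : nat)
    (s : seq (set (euclidean R n))) (F : seq (euclidean R n -> R))
    (phi : (euclidean R n -> R) -> R) (k : nat) :
  \sum_(g <- iter k (sparse_step s) F) phi g =
  \sum_(h <- F) \sum_(g <- iter k (sparse_step s) [:: h]) phi g.
Proof.
have iter_cat F1 F2 : iter k (sparse_step s) (F1 ++ F2) =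
    iter k (sparse_step s) F1 ++ iter k (sparse_step s) F2.
  by elim: k => //= k ->; rewrite /sparse_step allpairs_cat.
have iter0 : iter k (sparse_step s) [::] = [::] by elim: k {iter_cat} => //= k ->.
elim: F => [|h F IH]; first by rewrite iter0 !big_nil.
by rewrite -cat1s iter_cat !big_cat big_seq1 /= IH.
Qed.

Lemma ler_sum_perm_filter (R : realType) (T : eqType) (s t : seq T)
    (P : pred T) (x0 : T) (phi : T -> R) : perm_eq t [seq y <- s | P y] ->
  (forall y, 0 <= phi y) ->
  \sum_(0 <= j < size t) phi (nth x0 t j) <= \sum_(y <- s) phi y.
Proof.
move=> st phi0; rewrite -(big_nth x0 xpredT phi) (perm_big _ st) big_filter.
by rewrite [leRHS](bigID P)/= lerDl sumr_ge0.
Qed.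

(* The binomial coefficient is the number of decreasing chains of length k of
   cubes of t contained in Q_i. *)
Lemma chains_le_iter (R : realType) (n : nat) (q : R)
    (s t : seq (set (euclidean R n))) (x : euclidean R n) (k i : nat) (c : R) :
  (forall Q, Q \in s -> is_cube Q) ->
  perm_eq t [seq Q <- s | x \in Q] ->
  (forall i j, (i <= j < size t)%N -> nth set0 t i `<=` nth set0 t j) ->
  0 <= c -> (i < size t)%N ->
  'C(i + k, k)%:R * c `^ q <=
  \sum_(g <- iter k (sparse_step s) [:: scaled_indic c (nth set0 t i)])
    `|g x| `^ q.
Proof.
move=> cs st nest c0.
have inS j : (j < size t)%N -> nth set0 t j \in s /\ nth set0 t j x.
  move=> jt; have := mem_nth set0 jt.
  by rewrite (perm_mem st) mem_filter => /andP[/set_mem].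
elim: k i => [|k IH] i it.
  by rewrite bin0 mul1r big_seq1 scaled_indic_in ?ger0_norm//; exact: (inS _ it).2.
have cube_nth j (jt : (j < size t)%N) := cs _ (inS _ jt).1.
(* The first of the k + 1 steps selects a cube of [s]; only the cubes containing x, listed in [t],
   are kept. *)
rewrite iterSr sum_iter_sparse_step /sparse_step big_allpairs_dep big_seq1.
apply: le_trans (ler_sum_perm_filter set0 st _); last first.
  by move=> Q; apply: sumr_ge0 => g _; exact: powR_ge0.
(* Among these only Q_j with j <= i are retained: they lie in Q_i, so averaging over them preserves
   the constant c. *)
rewrite (big_cat_nat (leq0n i.+1) it)/= ler_wpDr//.
  by apply: sumr_ge0 => Q _; apply: sumr_ge0 => g _; exact: powR_ge0.
(* By induction Q_j contributes at least C(j + k, k) c^q, and the hockey-stick identity adds these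
   up. *)
rewrite -bin_hockey_stick natr_sum mulr_suml; apply: ler_sum_nat => j /andP[_ ji].
rewrite favg_indic_sub ?IH ?(leq_trans ji)//.
- exact: measurable_is_cube (cube_nth _ it).
- exact: cube_nth (leq_trans ji it).
- by apply: nest; rewrite -ltnS ji.
Qed.

(** The first of the p + 1 steps produces the average of f on each Q_j; the other p multiply its
    q-th power in the sum at x by at least C(j + p, p), the weight in [sum_le_Gamma_const]. *)
Lemma sparse_sum_le_iter (R : realType) (n : nat) (q : R) (p : nat)
    (s : seq (set (euclidean R n))) (f : euclidean R n -> R)
    (x : euclidean R n) : 1 < q -> q < p.+1%:R ->
  (forall Q, Q \in s -> is_cube Q) ->
  (forall P Q, P \in s -> Q \in s -> [\/ P `&` Q = set0, P `<=` Q | Q `<=` P]) ->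
  \sum_(Q <- s) favg f Q * \1_Q x <=
  Gamma_const q p.+1 *
    lq_norm q (iter p.+1 (sparse_step s) [:: f]) x.
Proof.
move=> q1 qp cs ds; have [t [st nest]] := sorted_cubes_at x ds.
have inS j : (j < size t)%N -> nth set0 t j \in s.
  by move=> jt; have := mem_nth set0 jt; rewrite (perm_mem st) mem_filter => /andP[].
(* The absolute value makes the sequence nonnegative at every index, also past the end of [t], where
   [nth] returns [set0]. *)
have -> : \sum_(Q <- s) favg f Q * \1_Q x =
    \sum_(0 <= j < size t) `|favg f (nth set0 t j)|.
  rewrite (bigID (fun Q => x \in Q))/= [X in _ + X]big1 ?addr0; last first.
    by move=> Q xQ; rewrite indicE (negbTE xQ) mulr0.
  rewrite -big_filter -(perm_big _ st) (big_nth set0) big_nat [RHS]big_nat.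
  apply: eq_bigr => j /andP[_ jt].
  rewrite (ger0_norm (favg_ge0 _ (cs _ (inS _ jt)))).
  have := mem_nth set0 jt; rewrite (perm_mem st) mem_filter => /andP[xQ _].
  by rewrite indicE xQ mulr1.
apply: (le_trans (sum_le_Gamma_const (a := fun j =>
  `|favg f (nth set0 t j)|) _ q1 qp _)) => //.
have G0 : 0 <= Gamma_const q p.+1 by exact: powR_ge0.
apply: ler_wpM2l => //.
have S0 : 0 <= \sum_(0 <= k < size t)
    'C(k + p, p)%:R * `|favg f (nth set0 t k)| `^ q.
  by apply: sumr_ge0 => k _; rewrite mulr_ge0 ?powR_ge0.
rewrite /lq_norm ge0_ler_powR ?nnegrE ?invr_ge0 ?sum_powR_ge0//.
  by rewrite (le_trans ler01) ?ltW.
rewrite iterSr sum_iter_sparse_step /sparse_step big_allpairs_dep big_seq1.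
apply: le_trans (ler_sum_perm_filter set0 st _); last first.
  by move=> Q; apply: sumr_ge0 => g _; exact: powR_ge0.
apply: ler_sum_nat => j /andP[_ jt].
have a0 := favg_ge0 f (cs _ (inS _ jt)).
by rewrite (ger0_norm a0); exact: chains_le_iter.
Qed.

(** * From the dyadic grid to the norm bound for the sparse operator *)

Lemma dyadic_grid_is_cube (R : realType) (n : nat)
    (D : set (set (euclidean R n))) (Q : set (euclidean R n)) :
  dyadic_grid D -> D Q -> is_cube Q.
Proof.
move=> [Dk [-> Dcube _ _ _]] [k _ /(Dcube k).2[a ->]].
by exists a, (2 ^ (- k)); split; rewrite ?exprz_gt0.
Qed.

Unset Implicit Arguments.

Theorem corollary3p3 (R : realType) (n : nat) (n_gt0 : (0 < n)%N)
    (X : ballBanachSpace R n) (q : R) (q_gt1 : 1 < q)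
    (C : R) (C_gt0 : 0 < C)
    (maximal_bound : forall (N : nat) (f : 'I_N -> euclidean R n -> R),
      (forall j, measurable_fun [set: euclidean R n] (f j)) ->
      (bbs_enorm X (lq_sum q (fun j x => `|f j x|%:E)) < +oo)%E ->
      (bbs_enorm X (lq_sum q (fun j => maximal (f j))) <=
        C%:E * bbs_enorm X (lq_sum q (fun j x => `|f j x|%:E)))%E)
    (m : nat) (q_lt_m : q < m%:R) (eta : R) (eta_gt0 : 0 < eta)
    (eta_lt1 : eta < 1) (D S : set (set (euclidean R n)))
    (D_grid : dyadic_grid D) (S_sub : S `<=` D) (S_fin : finite_set S)
    (S_sparse : sparse eta S) (f : euclidean R n -> R) (Xf : bbs_mem X f) :
  (bbs_enorm X (sparse_operator S f) <=
    (Gamma_const q m * (eta^-1 * C ^+ 2) ^+ m * bbs_norm X f)%:E)%E.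
Proof.
have q0 : 0 < q := lt_trans ltr01 q_gt1.
(* Since q > 0, the case m = 0 is impossible, and m = p + 1. *)
case: m q_lt_m => [|p qp]; first by rewrite ltNge (ltW q0).
pose s : seq (set (euclidean R n)) := fset_set S.
have sS Q : Q \in s -> S Q by rewrite in_fset_set// => /set_mem.
have cs Q : Q \in s -> is_cube Q.
  by move=> /sS/S_sub; exact: dyadic_grid_is_cube.
have ds P Q : P \in s -> Q \in s -> [\/ P `&` Q = set0, P `<=` Q | Q `<=` P].
  by case: D_grid => Dk [_ _ _ _ DD] /sS/S_sub DP /sS/S_sub DQ; exact: DD.
have [E [tE SE]] := S_sparse.
have tE' : trivIset [set` s] E by apply: sub_trivIset tE => Q /sS.
have [XI HI] := iter_sparse_step_bounded (X := X) p.+1 maximal_bound q0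
  (ltW C_gt0) eta_gt0 (fset_uniq _) cs tE' (fun Q Qs => SE Q (sS Q Qs)) Xf.
set I := lq_norm _ _ in XI HI.
have G0 : 0 <= Gamma_const q p.+1 by exact: powR_ge0.
pose A x := \sum_(Q <- s) favg f Q * \1_Q x.
have A0 x : 0 <= A x.
  rewrite /A big_seq sumr_ge0// => Q Qs; rewrite mulr_ge0// favg_ge0//.
  exact: cs.
(* The averages of f over the cubes of S are finite, so the extended-valued operator is the real
   function [A]. *)
have SA x : sparse_operator S f x = (A x)%:E.
  rewrite /sparse_operator fsbig_finite// /A -sumEFin big_seq [RHS]big_seq.
  apply: eq_bigr => Q Qs; rewrite EFinM /favg fineK//.
  by apply: (average_fin_num Xf); exact: cs.
have mA : measurable_fun [set: euclidean R n] A.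
  (* The membership test makes the summand measurable for every set Q, not only for the cubes in
     [s]. *)
  rewrite /A (_ : (fun x => _) =
    fun x => \sum_(Q <- s) if Q \in s then favg f Q * \1_Q x else 0).
    apply: (@measurable_sum _ _ _ _ _ s (fun Q x =>
      if Q \in s then favg f Q * \1_Q x else 0)) => Q.
    case: (boolP (Q \in s)) => [Qs|_]; last exact: measurable_cst.
    exact: measurable_scaled_indic (measurable_is_cube (cs _ Qs)).
  by apply/funext => x; rewrite big_seq big_mkcond.
(* The ideal property turns the pointwise bound into membership in X and a norm bound. *)
have [XA HA] : bbs_mem X A /\ bbs_norm X A <= bbs_norm X (Gamma_const q p.+1 \*o I).
  apply: (bbs_ideal (bbs_memZ _ XI) mA); apply: aeW => x /=.
  rewrite ger0_norm// (le_trans _ (ler_norm _))//.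
  exact: sparse_sum_le_iter.
rewrite (bbs_enormE XA); last by apply: aeW => x; rewrite SA.
rewrite lee_fin (le_trans HA)// bbs_normZ// ger0_norm// -mulrA.
exact: ler_wpM2l.
Qed.
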